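(* Let $\widetilde{s}_n$ be the number of unlabeled split graphs on $n$ vertices and let $s_n$ be the number of labeled split graphs on $n$ vertices. Then $\widetilde{s}_n\sim s_n/n!$ as $n\to\infty$.
   Context: Graphs are finite and simple. A split graph is a graph whose vertices can be partitioned into two (possibly empty) sets $K$ and $S$ such that $K$ is a clique and $S$ is a stable (independent) set. Labeled graphs on $n$ vertices are graphs with vertex set $\{1,\dots,n\}$; unlabeled graphs on $n$ vertices are isomorphism classes of graphs on $n$ vertices. The notation $x_n\sim y_n$ means $\lim_{n\to\infty}x_n/y_n=1$. *)

(* Defs.v *)
From mathcomp Require Import all_boot all_fingroup.

Set Implicit Arguments.
Unset Strict Implicit.
Unset Printing Implicit Defensive.

(* A finite simple graph on the vertex set T is given by its set of edges,
   which are 2-element subsets of T. *)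
Definition graphs (T : finType) : {set {set {set T}}} :=
  [set G : {set {set T}} | [forall e in G, #|e| == 2]].

Definition adj (T : finType) (G : {set {set T}}) (x y : T) : bool :=
  [set x; y] \in G.

Definition clique (T : finType) (G : {set {set T}}) (K : {set T}) : bool :=
  [forall x in K, forall y in K, (x != y) ==> adj G x y].

Definition stable (T : finType) (G : {set {set T}}) (S : {set T}) : bool :=
  [forall x in S, forall y in S, (x != y) ==> ~~ adj G x y].

Definition split_graph (T : finType) (G : {set {set T}}) : bool :=
  [exists K : {set T}, exists S : {set T},
    [&& K :|: S == [set: T], [disjoint K & S], clique G K & stable G S]].

Definition graph_iso (T : finType) (G H : {set {set T}}) : bool :=
  [exists s : {perm T},
    [forall x : T, forall y : T, adj H (s x) (s y) == adj G x y]].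

Definition iso_class (T : finType) (G : {set {set T}}) : {set {set {set T}}} :=
  [set H in graphs T | graph_iso G H].

(* Vertices are labeled 0, ..., n - 1. *)
Definition labeled_split_graphs (n : nat) : {set {set {set 'I_n}}} :=
  [set G in graphs 'I_n | split_graph G].

Definition unlabeled_split_graphs (n : nat) : {set {set {set {set 'I_n}}}} :=
  [set iso_class G | G in labeled_split_graphs n].

Definition num_labeled_split (n : nat) : nat := #|labeled_split_graphs n|.

Definition num_unlabeled_split (n : nat) : nat := #|unlabeled_split_graphs n|.

(* Main.v *)
(** Burnside's lemma gives [n! u_n = sum_s fix(s)], where [u_n] and [s_n] are
    the unlabeled and labeled counts and [fix(s)] is the number of labeled
    split graphs invariant under the permutation [s]; the identity
    contributes [s_n], so it suffices that the other terms are [o(s_n)].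

    Fix a clique side [K] and let [s] move [m] points.  An invariant split graph
    is constant on the orbits of edges, so at least half of the
    [#|K| (n - #|K|)] crossing edges that are not fixed by [s] are redundant.
    Hence [fix(s) <= 2^n 2^(n^2/4) (2 / 2^(n/8))^m], and summing over [s <> 1]
    gives at most [2^n 2^(n^2/4) ((1 + 2n / 2^(n/8))^n - 1)].

    Conversely [2^n 2^(n^2/4) <= (n+1)^3 s_n]: take [#|K| = n/2], and observe
    that a graph has at most [(n+1)^2] split partitions because two of them
    differ by at most one vertex in each direction.  The exponentially small
    factor absorbs the polynomial loss. *)

Require Import Defs.
From mathcomp Require Import all_boot all_fingroup all_order all_algebra zify lra.

Set Implicit Arguments.
Unset Strict Implicit.
Unset Printing Implicit Defensive.

Import Order.TTheory GRing.Theory Num.Theory.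

(** * Split partitions and crossing edges *)

Section SplitGraphs.
Local Open Scope nat_scope.
Variable T : finType.
Implicit Types (G H : {set {set T}}) (K L e : {set T}) (s : {perm T}).

Definition crossing K : {set {set T}} := [set [set x; y] | x in K, y in ~: K].

Definition split_along G K : bool :=
  [&& G \in graphs T, clique G K & stable G (~: K)].

Lemma card_edge G e : G \in graphs T -> e \in G -> #|e| = 2.
Proof. by rewrite inE => /forall_inP GT /GT/eqP. Qed.

Lemma split_graphE G : G \in graphs T -> split_graph G = [exists K, split_along G K].
Proof.
move=> GT; apply/existsP/existsP => [[K /existsP[S /and4P[/eqP KS dKS cK sS]]]|[K]].
  exists K; rewrite /split_along GT cK; suff -> : ~: K = S by [].
  apply/setP=> x; rewrite inE; have := in_setT x; rewrite -KS inE.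
  have [xK _|_ /= ->] //= := boolP (x \in K).
  by rewrite (disjointFr dKS).
move=> /and3P[_ cK sK]; exists K; apply/existsP; exists (~: K).
by rewrite setUCr eqxx disjoints_subset setCK subxx cK sK.
Qed.

(** Pairs inside [K] are forced to be edges and pairs inside its complement are forced not to be, so
    graphs along the same [K] can differ only on crossing edges. *)
Lemma noncrossing_edge G H K e : split_along G K -> split_along H K ->
  e \notin crossing K -> e \in G -> e \in H.
Proof.
move=> /and3P[GT cG sG] /and3P[HT cH sH] eK eG.
have /eqP/cards2P[x [y [xy exy]]] := card_edge GT eG.
have xyK : (x \in K) = (y \in K).
  apply/idP/idP=> uK; apply/negPn/negP=> vK; case/negP: eK; rewrite exy.
    by apply/imset2P; exists x y; rewrite ?inE.
  by rewrite setUC; apply/imset2P; exists y x; rewrite ?inE.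
have [xK|xK] := boolP (x \in K).
  have /forall_inP/(_ x xK)/forall_inP/(_ y) := cH.
  by rewrite -xyK xK xy /adj -exy /= => /(_ isT).
have /forall_inP/(_ x)/= := sG; rewrite inE xK => /(_ isT)/forall_inP/(_ y).
by rewrite inE -xyK xK xy /= /adj -exy eG => /(_ isT).
Qed.

(** * Permutations acting on edges *)

Definition edge_act s e : {set T} := s @: e.

Lemma edge_act_inj s : injective (edge_act s).
Proof. exact: imset_inj perm_inj. Qed.

(* An invariant graph is determined by these edges: if the root [r] of an orbit
   or its image [s r] is not crossing, then membership of the orbit is forced
   by [K]. *)
Definition free_edges s K : {set {set T}} :=
  [set e in crossing K |
    froots (edge_act s) e && (edge_act s e \in crossing K)].

Lemma invariant_edge s G e : edge_act s @: G = G -> (edge_act s e \in G) = (e \in G).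
Proof. by move=> sG; rewrite -{1}sG mem_imset //; apply: edge_act_inj. Qed.

(** The trace on [free_edges s K] determines an invariant graph along [K], so taking traces is
    injective into the subsets of [free_edges s K]. *)
Lemma card_invariant_along s K :
  #|[set G | split_along G K & edge_act s @: G == G]| <= 2 ^ #|free_edges s K|.
Proof.
rewrite -card_powerset; set X := [set _ | _].
(* One half of injectivity: membership of [e] is transferred to the root [r] of its orbit, where
   either [r] is free or [K] decides [r] or its image. *)
have sub G H : G \in X -> H \in X -> G :&: free_edges s K \subset H -> G \subset H.
  rewrite !inE => /andP[GK /eqP sG] /andP[HK /eqP sH] /subsetP GH.
  apply/subsetP=> e eG; set r := froot (edge_act s) e.
  have root_in (F : {set {set T}}) : edge_act s @: F = F -> (r \in F) = (e \in F).
    move=> sF; apply/esym/(@closed_connect _ (frel (edge_act s))).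
      by move=> x y /eqP <-; rewrite invariant_edge.
    exact: connect_root.
  have rG : r \in G by rewrite root_in.
  rewrite -(root_in H) //.
  have [rK|rK] := boolP (r \in crossing K); last exact: noncrossing_edge GK HK rK rG.
  have [srK|srK] := boolP (edge_act s r \in crossing K).
    apply: GH; rewrite inE rG inE rK srK andbT roots_root //.
    exact/fconnect_sym/edge_act_inj.
  rewrite -(invariant_edge r sH); apply: noncrossing_edge GK HK srK _.
  by rewrite invariant_edge.
rewrite -(@card_in_imset _ _ (fun G => G :&: free_edges s K) X).
  apply/subset_leq_card/subsetP=> _ /imsetP[G _ ->].
  by rewrite inE subsetIr.
move=> G H GX HX /= GH; apply/eqP; rewrite eqEsubset.
by apply/andP; split; apply: sub => //; [rewrite GH|rewrite -GH]; exact: subsetIl.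
Qed.

(** * Bounding the number of free edges *)

Definition moved s : {set T} := [set x | s x != x].

(** A crossing edge fixed by [s] either has both ends fixed, or has its ends swapped and is then of
    the form [[set x; s x]] with [x] moved. *)
Lemma card_fixed_crossing s K :
  #|[set e in crossing K | edge_act s e == e]|
    <= #|K :\: moved s| * #|~: K :\: moved s| + #|moved s|.
Proof.
set A := [set [set x; y] | x in K :\: moved s, y in ~: K :\: moved s].
set B := [set [set x; s x] | x in moved s].
apply: (@leq_trans #|A :|: B|); last first.
  rewrite cardsU; apply: leq_trans (leq_subr _ _) (leq_add _ _).
    by rewrite -cardsX /A curry_imset2X leq_imset_card.
  exact: leq_imset_card.
apply/subset_leq_card/subsetP=> e; rewrite inE => /andP[/imset2P[x y xK yK ->]].
rewrite /edge_act imsetU1 imset_set1 inE => /eqP sxy.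
have := set21 (s x) (s y); have := set22 (s x) (s y); rewrite !sxy !inE.
have [sx|sx _] := eqVneq (s x) x; last first.
  move=> /eqP sxE; apply/orP; right; apply/imsetP; exists x; rewrite ?inE //.
  by rewrite sxE.
have [sy _ _|sy] := eqVneq (s y) y.
  by apply/orP; left; apply/imset2P; exists x y; rewrite ?inE ?sx ?sy ?eqxx //= -in_setC.
rewrite orbF -{1}sx (inj_eq perm_inj) => /eqP yx.
by move: yK; rewrite inE yx xK.
Qed.

(** With [R] the free edges and [F] the fixed crossing edges, [R :\: F] and its image under [s] are
    disjoint sets of unfixed crossing edges. Hence [2 |R|] is at most the number of crossing edges
    plus [|F|]. *)
Lemma double_card_free_edges s K :
  2 * #|free_edges s K| <=
    #|K| * #|~: K| + #|K :\: moved s| * #|~: K :\: moved s| + #|moved s|.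
Proof.
rewrite -addnA; apply: leq_trans (leq_add (leqnn _) (card_fixed_crossing s K)).
set F := [set e in _ | _]; set R := free_edges s K.
have cE : #|crossing K| <= #|K| * #|~: K|.
  by rewrite -cardsX /crossing curry_imset2X leq_imset_card.
apply: leq_trans (leq_add cE (leqnn _)).
have RE : R \subset crossing K by apply/subsetP=> e; rewrite inE => /andP[].
rewrite -(cardsID F R) -(cardsID F (crossing K)).
have -> : crossing K :&: F = F by apply/setIidPr/subsetP=> e; rewrite inE => /andP[].
have RF : #|R :&: F| <= #|F| by apply/subset_leq_card/subsetIr.
suff: #|R :\: F| + #|edge_act s @: (R :\: F)| <= #|crossing K :\: F|.
  rewrite card_imset; last exact: edge_act_inj.
  by move=> RD; rewrite mul2n -addnn addnACA [leqRHS]addnAC leq_add // leq_add.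
have dR : [disjoint R :\: F & edge_act s @: (R :\: F)].
  rewrite -setI_eq0; apply/eqP/setP=> e; rewrite in_set0; apply/negP.
  case/setIP=> /setDP[eR eF] /imsetP[f /setDP[fR fF] ef].
  (* Both are roots of the same orbit, so they coincide, and the edge would be fixed by [s]. *)
  have fe : e = f.
    move: eR fR; rewrite !inE => /and3P[_ /eqP <- _] /and3P[_ /eqP <- _].
    apply/eqP; rewrite root_connect; last exact/fconnect_sym/edge_act_inj.
    by rewrite fconnect_sym ?ef ?fconnect1 //; apply: edge_act_inj.
  case/negP: eF; rewrite inE (subsetP RE) //=.
  by rewrite {2}ef fe.
rewrite -cardsUI; move: dR; rewrite -setI_eq0 => /eqP ->; rewrite cards0 addn0.
apply/subset_leq_card/subsetP=> e /setUP[/setDP[eR eF]|/imsetP[f /setDP[fR fF] ->]].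
  by rewrite !in_setD eF (subsetP RE).
have sfE : edge_act s f \in crossing K by move: fR; rewrite !inE => /and3P[].
rewrite in_setD sfE andbT; apply/negP; rewrite inE sfE /= (inj_eq (@edge_act_inj s)) => ff.
by case/negP: fF; rewrite inE (subsetP RE).
Qed.

(** The inequality of arithmetic and geometric means bounds both products, and
    [(n - m) ^ 2 + m * n <= n ^ 2] yields the gain of [m * n / 8]. The remaining [m / 2] is relaxed
    to [m], which absorbs the rounding. *)
Lemma card_free_edges s K :
  #|free_edges s K| + #|T| %/ 8 * #|moved s| <= #|T| ^ 2 %/ 4 + #|moved s|.
Proof.
have := double_card_free_edges s K.
set R := #|free_edges s K|; set m := #|moved s|; set n := #|T|.
set a := #|K :\: _|; set b := #|~: K :\: _|.
have kl : #|K| + #|~: K| = n by rewrite cardsC.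
have abm : a + b + m = n.
  rewrite /n -(cardsC (moved s)) addnC; congr (_ + _).
  rewrite -(cardsID K (~: moved s)); congr (_ + _); apply: eq_card => x.
    by rewrite !inE andbC.
  by rewrite !inE andbC.
move: kl; set k := #|K|; set l := #|~: K| => kl RE.
clearbody R m n a b k l.
have kl4 : 4 * (k * l) <= n ^ 2 by rewrite -kl nat_AGM2.
have ab4 : 4 * (a * b) <= (n - m) ^ 2 by rewrite -abm addnK nat_AGM2.
have mn : m <= n by rewrite -abm leq_addl.
have nm : (n - m) ^ 2 + m * n <= n ^ 2 by nia.
have p8 : 8 * (n %/ 8) * m <= n * m by rewrite leq_mul // mulnC leq_divM.
by move: (n %/ 8) p8 => p p8; lia.
Qed.

(** * Counting invariant split graphs *)

Definition split_graphs : {set {set {set T}}} := [set G in graphs T | split_graph G].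

Lemma mem_split_graphs G : (G \in split_graphs) = [exists K, split_along G K].
Proof.
rewrite inE; have [GT|GT] := boolP (G \in graphs T); first exact: split_graphE.
by apply/esym/existsP=> -[K /and3P[]]; rewrite (negPf GT).
Qed.

(** Union bound over the [2 ^ #|T|] choices of [K]. The gain stands as a factor on the left so that
    the inequality stays in [nat] without division. *)
Lemma card_invariant_split s :
  #|[set G in split_graphs | edge_act s @: G == G]| * 2 ^ (#|T| %/ 8 * #|moved s|)
    <= 2 ^ #|T| * 2 ^ (#|T| ^ 2 %/ 4) * 2 ^ #|moved s|.
Proof.
set X := [set _ in _ | _].
have XE : X \subset \bigcup_K [set G | split_along G K & edge_act s @: G == G].
  apply/subsetP=> G; rewrite inE mem_split_graphs => /andP[/existsP[K GK] sG].
  by apply/bigcupP; exists K; rewrite // inE GK.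
have: #|X| <= \sum_(K : {set T}) 2 ^ #|free_edges s K|.
  apply: leq_trans (subset_leq_card XE) _.
  apply: (big_rec2 (fun (A : {set {set {set T}}}) c => #|A| <= c)) => [|K A c _ Ac].
    by rewrite cards0.
  rewrite cardsU; apply: leq_trans (leq_subr _ _) (leq_add _ Ac).
  exact: card_invariant_along.
move=> /(@leq_mul _ _ _ _ ^~ (leqnn (2 ^ (#|T| %/ 8 * #|moved s|)))) /leq_trans; apply.
rewrite big_distrl /= -mulnA -expnD.
have cP : 2 ^ #|T| = \sum_(K : {set T}) 1 by rewrite -cardsT -card_powerset powersetT sum1_card cardsT.
rewrite cP big_distrl /=; apply: leq_sum => K _.
by rewrite mul1n -expnD leq_exp2l // card_free_edges.
Qed.

(** * Lower bound for the number of labeled split graphs *)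

Lemma split_along_diff G K L : split_along G K -> split_along G L -> #|K :\: L| <= 1.
Proof.
move=> /and3P[_ cK _] /and3P[_ _ sL]; apply/card_le1P=> x /setDP[xK xL] y.
rewrite [RHS]inE; apply/idP/eqP=> [/setDP[yK yL]|-> //]; last by rewrite inE xL.
(* Two distinct vertices of [K :\: L] would be adjacent in the clique [K] and non-adjacent in the
   stable set [~: L]. *)
apply/eqP/negPn/negP=> yx.
have /forall_inP/(_ x xK)/forall_inP/(_ y yK) := cK.
have /forall_inP/(_ x)/= := sL; rewrite inE xL => /(_ isT)/forall_inP/(_ y).
by rewrite inE yL eq_sym yx => /(_ isT) /= /negPf ->.
Qed.

(** Given one side [K0], any other side [K] is recovered from [K :\: K0] and [K0 :\: K]. Each is
    empty or a singleton, hence coded by an element of [option T]. *)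
Lemma card_split_along G : #|[set K | split_along G K]| <= #|T|.+1 ^ 2.
Proof.
case: (set_0Vmem [set K | split_along G K]) => [->|[K0]]; first by rewrite cards0.
rewrite inE => GK0.
pose o (a : option T) : {set T} := if a is Some x then [set x] else set0.
have oP (A : {set T}) : #|A| <= 1 -> exists a, A = o a.
  rewrite leq_eqVlt ltnS leqn0 => /orP[/cards1P[x ->]|]; first by exists (Some x).
  by rewrite cards_eq0 => /eqP ->; exists None.
pose f (ab : option T * option T) := (o ab.1 :|: K0) :\: o ab.2.
apply: (@leq_trans #|f @: setT|); last first.
  by rewrite (leq_trans (leq_imset_card _ _)) // cardsT card_prod card_option mulnn.
apply/subset_leq_card/subsetP=> K; rewrite inE => GK.
have [a aE] := oP _ (split_along_diff GK GK0).
have [b bE] := oP _ (split_along_diff GK0 GK).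
apply/imsetP; exists (a, b); rewrite // /f /= -aE -bE.
by apply/setP=> x; rewrite !inE; case: (x \in K); case: (x \in K0).
Qed.

(** Making [K] complete and adding any set [B] of crossing pairs gives a graph along [K], from which
    [B] can be read off. *)
Lemma card_graphs_along K : 2 ^ (#|K| * #|~: K|) <= #|[set G | split_along G K]|.
Proof.
pose f (B : {set T * T}) : {set {set T}} :=
  [set e : {set T} | (#|e| == 2) && (e \subset K)] :|: [set [set p.1; p.2] | p in B].
have fE (B : {set T * T}) x y : B \subset setX K (~: K) -> x \in K -> y \notin K ->
    ([set x; y] \in f B) = ((x, y) \in B).
  move=> /subsetP BK xK yK; rewrite !inE subUset !sub1set (negPf yK) !andbF /=.
  apply/imsetP/idP=> [[[u v] uv /= xyE]|xyB]; last by exists (x, y).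
  have := BK _ uv; rewrite !inE /= => /andP[uK vK].
  have := set21 x y; rewrite xyE !inE => /orP[] /eqP xE; last first.
    by move: vK; rewrite -xE xK.
  have := set22 x y; rewrite xyE !inE => /orP[] /eqP yE.
    by move: yK; rewrite yE uK.
  by rewrite xE yE.
rewrite -cardsX -card_powerset -(@card_in_imset _ _ f).
  apply/subset_leq_card/subsetP=> _ /imsetP[B + ->]; rewrite !inE => BK.
  have GT : f B \in graphs T.
    rewrite inE; apply/forall_inP=> e; rewrite !inE => /orP[/andP[]//|/imsetP[[x y] /= xyB ->]].
    have := subsetP BK _ xyB; rewrite !inE /= => /andP[xK yK].
    by rewrite cards2 (_ : x != y) //; apply: contraNneq yK => <-.
  rewrite /split_along GT /=; apply/andP; split.
    apply/forall_inP=> x xK; apply/forall_inP=> y yK; apply/implyP=> xy.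
    by rewrite /adj !inE cards2 xy subUset !sub1set xK yK.
  apply/forall_inP=> x; rewrite inE => xK; apply/forall_inP=> y; rewrite inE => yK.
  apply/implyP=> xy; rewrite /adj !inE subUset sub1set (negPf xK) andbF /=.
  apply/imsetP=> -[[u v] /= uv xyE].
  have := subsetP BK _ uv; rewrite !inE /= => /andP[uK _].
  have := set21 u v; rewrite -xyE !inE => /orP[] /eqP uE; move: uK; rewrite uE.
    by rewrite (negPf xK).
  by rewrite (negPf yK).
move=> B C; rewrite !inE => BK CK fBC; apply/setP=> -[x y].
have [/andP[xK yK]|xyK] := boolP ((x \in K) && (y \notin K)).
  by rewrite -!fE // fBC.
have out (D : {set T * T}) : D \subset setX K (~: K) -> ((x, y) \in D) = false.
  by move=> DK; apply/negP=> /(subsetP DK); rewrite !inE /= (negPf xyK).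
by rewrite !out.
Qed.

(** Double counting of pairs of a graph and a clique side. Sides of size [n./2] already give the
    left-hand side, since [n./2 * (n - n./2)] is the floor of [n ^ 2 / 4]. *)
Lemma card_split_graphs_ge :
  'C(#|T|, #|T|./2) * 2 ^ (#|T| ^ 2 %/ 4) <= #|T|.+1 ^ 2 * #|split_graphs|.
Proof.
set n := #|T|.
have half : n./2 * (n - n./2) = n ^ 2 %/ 4.
  by have := odd_double_half n; case: (odd n); nia.
apply: (@leq_trans (\sum_(K : {set T}) #|[set G | split_along G K]|)).
  rewrite -card_draws -sum1_card big_distrl /=.
  rewrite [leqRHS](bigID [pred K : {set T} | #|K| == n./2]) /=.
  apply: leq_trans (leq_addr _ _).
  under eq_bigl do rewrite inE.
  apply: leq_sum => K /eqP cK; rewrite mul1n -half.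
  have := card_graphs_along K; have := cardsC K; rewrite -/n cK => cCK.
  by have -> : #|~: K| = n - n./2 by lia.
under eq_bigr do rewrite -sum1dep_card.
rewrite (exchange_big_dep [in split_graphs]) /=; last first.
  by move=> K G _ GK; rewrite mem_split_graphs; apply/existsP; exists K.
rewrite -sum1_card big_distrr /=; apply: leq_sum => G _.
by rewrite muln1 sum1dep_card card_split_along.
Qed.

(** * Isomorphism classes as orbits, and Burnside's lemma *)

Lemma graph_ext G H : G \in graphs T -> H \in graphs T ->
  (forall x y, adj G x y = adj H x y) -> G = H.
Proof.
move=> GT HT GH; apply/setP=> e; apply/idP/idP=> eE.
  have /eqP/cards2P[x [y [_ exy]]] := card_edge GT eE.
  by move: eE (GH x y); rewrite /adj -exy => -> <-.
have /eqP/cards2P[x [y [_ exy]]] := card_edge HT eE.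
by move: eE (GH x y); rewrite /adj -exy => -> ->.
Qed.

Lemma adj_act s G x y : adj (edge_act s @: G) (s x) (s y) = adj G x y.
Proof.
rewrite /adj (_ : [set s x; s y] = edge_act s [set x; y]).
  by rewrite mem_imset //; apply: edge_act_inj.
by rewrite /edge_act imsetU1 imset_set1.
Qed.

Lemma graphs_act s G : G \in graphs T -> edge_act s @: G \in graphs T.
Proof.
move=> GT; rewrite inE; apply/forall_inP=> _ /imsetP[e eG ->].
by rewrite card_imset ?(card_edge GT eG) //; apply: perm_inj.
Qed.

Lemma split_along_act s G K :
  split_along G K -> split_along (edge_act s @: G) (s @: K).
Proof.
move=> /and3P[GT /forall_inP cK /forall_inP sK]; rewrite /split_along graphs_act //=.
apply/andP; split.
  apply/forall_inP=> _ /imsetP[x xK ->]; apply/forall_inP=> _ /imsetP[y yK ->].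
  by rewrite adj_act (inj_eq perm_inj); have /forall_inP/(_ y yK) := cK x xK.
apply/forall_inP=> x; rewrite -[x](permKV s) inE mem_imset; last exact: perm_inj.
rewrite -in_setC => xK; apply/forall_inP=> y.
rewrite -[y](permKV s) inE mem_imset; last exact: perm_inj.
rewrite -in_setC adj_act (inj_eq perm_inj) => yK.
by have /forall_inP/(_ _ yK) := sK _ xK.
Qed.

(** This makes the orbit-counting lemma applicable. ['P^*^*] is the natural action on vertices
    lifted twice, to edges and then to edge sets. *)
Lemma iso_classE G : G \in graphs T ->
  iso_class G = orbit ('P^*^*)%act [set: {perm T}] G.
Proof.
move=> GT; apply/setP=> H; rewrite inE; apply/andP/orbitP => [[HT]|[s _ <-]].
  case/existsP=> s /forallP sH; exists s => //.
  apply: (@graph_ext (edge_act s @: G)) => // [|x y]; first exact: graphs_act.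
  rewrite -[x](permKV s) -[y](permKV s) adj_act.
  by have /forallP/(_ ((s^-1)%g y))/eqP := sH ((s^-1)%g x).
rewrite -[X in X \in _]/(edge_act s @: G) -[X in graph_iso _ X]/(edge_act s @: G).
split; first exact: graphs_act.
by apply/existsP; exists s; apply/forallP=> x; apply/forallP=> y; rewrite adj_act.
Qed.

Lemma sum_invariant_split :
  \sum_(s : {perm T}) #|[set G in split_graphs | edge_act s @: G == G]|
    = #|[set iso_class G | G in split_graphs]| * #|T|`!.
Proof.
have acts : [acts [set: {perm T}], on split_graphs | 'P^*^*].
  apply/actsP=> s _ G; rewrite !mem_split_graphs.
  apply/existsP/existsP=> -[K GK]; last by exists (s @: K); apply: split_along_act.
  have sGK : split_along (edge_act s @: G) K := GK.
  exists ((s^-1)%g @: K); have := split_along_act (s^-1)%g sGK.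
  congr (split_along _ _); rewrite -imset_comp -[RHS]imset_id; apply: eq_imset => e /=.
  by rewrite /edge_act -imset_comp -[RHS]imset_id; apply: eq_imset => x /=; rewrite permK.
have := Frobenius_Cauchy acts.
have cP : #|{perm T}| = #|T|`!.
  rewrite -(cardsT T) -card_perm; apply: eq_card => s; rewrite inE.
  by apply/esym/subsetP=> x; rewrite inE.
rewrite cardsT cP => FC.
have -> : [set iso_class G | G in split_graphs]
        = [set orbit ('P^*^*)%act [set: {perm T}] G | G in split_graphs].
  by apply: eq_in_imset => G; rewrite inE => /andP[GT _]; apply: iso_classE.
rewrite -FC; apply: eq_big => [s|s _]; first by rewrite inE.
by apply: eq_card => G; rewrite [LHS]in_set in_setI; congr (_ && _); apply/eqP/afix1P.
Qed.

End SplitGraphs.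


(** * Numerical estimates *)

Lemma central_bin_ge n : 2 ^ n <= n.+1 * 'C(n, n./2).
Proof.
(* The even case goes by induction from [2 j] to [2 j + 2] through row [2 j + 1]; the odd case then
   follows from the even one. *)
have rec j : j.*2.+1 * 'C(j.*2, j) = j.+1 * 'C(j.*2.+1, j).
  by rewrite (mul_bin_down j.*2.+1) subSn ?doubleK -?addnn ?leq_addr ?addnK.
have even j : 2 ^ j.*2 <= j.*2.+1 * 'C(j.*2, j).
  elim: j => // j IH; rewrite doubleS !expnS.
  have := mul_bin_diag j.*2.+2 j; have := rec j; move: IH => /=.
  move: (2 ^ _) 'C(_, _) 'C(_, _) 'C(_, _) => u a b c.
  by rewrite -muln2; nia.
rewrite -{1 2 3}(odd_double_half n); move: n./2 => j.
case: (odd n); last exact: even.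
rewrite add1n expnS; have := rec j; have := even j.
by move: (2 ^ _) 'C(_, _) 'C(_, _) => u a b; lia.
Qed.

(** The exponent 6 is 3 for the loss in the labeled count, 2 for the linearised error [n ^ 2 * t],
    and 1 to leave a decay of order [1 / n]. *)
Lemma exp6_le_exp2 : exists C, forall n, n.+1 ^ 6 <= C * 2 ^ (n %/ 8).
Proof.
(* Since [48 = 6 * 8], the bound [q + 1 <= 2 ^ q] raised to the sixth power costs only
   [6 * q <= n %/ 8] in the exponent. *)
exists (48 ^ 6) => n; set q := n %/ 48.
have nq : n.+1 <= 48 * q.+1 by rewrite mulnC ltn_ceil.
apply: (@leq_trans ((48 * q.+1) ^ 6)); first by rewrite leq_exp2r.
rewrite expnMn leq_mul2l; apply/orP; right.
apply: (@leq_trans ((2 ^ q) ^ 6)); first by rewrite leq_exp2r // ltn_expl.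
by rewrite -expnM leq_exp2l // leq_divRL // -mulnA leq_divM.
Qed.

(** * Sums over permutations weighted by moved points *)

Section WeightedPermutations.
Local Open Scope ring_scope.
Variables (R : realFieldType) (T : finType).
Implicit Types (s : {perm T}) (t : R).

Lemma moved1 : moved (1 : {perm T})%g = set0.
Proof. by apply/setP=> x; rewrite !inE perm1 eqxx. Qed.

(** The weight is a product over points, so enlarging the sum from permutations to all maps [T -> T]
    makes it factor pointwise: one image of weight 1, all others of weight [t]. *)
Lemma sum_exp_moved t : 0 <= t ->
  \sum_(s : {perm T}) t ^+ #|moved s| <= (1 + #|T|%:R * t) ^+ #|T|.
Proof.
move=> t0; pose w (x y : T) : R := if y == x then 1 else t.
have w0 x y : 0 <= w x y by rewrite /w; case: ifP.
have wE s : t ^+ #|moved s| = \prod_x w x (pval s x).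
  rewrite (bigID (mem (moved s))) /= [X in _ * X]big1 => [|x]; last first.
    by rewrite inE negbK -pvalE /w => ->.
  rewrite mulr1 -prodr_const; apply: eq_bigr => x; rewrite inE -pvalE /w.
  by move=> /negPf ->.
under eq_bigr do rewrite wE.
rewrite -(big_imset (fun f : {ffun T -> T} => \prod_x w x (f x)) (in2W val_inj)) /=.
apply: (@le_trans _ _ (\sum_(f : {ffun T -> T}) \prod_x w x (f x))).
  rewrite [leRHS](bigID (mem [set val s | s : {perm T}])) /= lerDl.
  by apply: sumr_ge0 => f _; apply: prodr_ge0.
rewrite -bigA_distr_bigA /= -[leRHS]prodr_const; apply: ler_prod => x _.
rewrite sumr_ge0 //= (bigD1 x) //= /w eqxx lerD2l.
apply: (@le_trans _ _ (\sum_(y | y != x) t)).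
  by apply: ler_sum => y /negPf ->.
by rewrite sumr_const mulr_natl ler_wpMn2l // max_card.
Qed.

(** In the induction the cross term [2 * n * v ^ 2] is at most [v] because [2 * n * v <= 1]. *)
Lemma expr_le_linear (v : R) n : 0 <= v -> n%:R * v <= 2^-1 ->
  (1 + v) ^+ n <= 1 + 2 * (n%:R * v).
Proof.
move=> v0; elim: n => [|n IH]; first by rewrite mul0r mulr0 addr0.
rewrite -natr1 => nv; have {}IH := IH _.
have nv2 : n%:R * v <= 2^-1 by nra.
rewrite exprSr; apply: le_trans (ler_wpM2r _ (IH nv2)) _; first by nra.
have n0 : 0 <= n%:R * v by rewrite mulr_ge0.
nra.
Qed.

End WeightedPermutations.

(** * Relative error of the unlabeled count *)

Section RelativeError.
Local Open Scope ring_scope.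
Variables (R : realFieldType) (C : nat).
Hypothesis C_bound : forall n, (n.+1 ^ 6 <= C * 2 ^ (n %/ 8))%N.
Implicit Types n : nat.

Let u n : R := (num_unlabeled_split n)%:R.
Let l n : R := (num_labeled_split n)%:R.
Let B n : R := 2 ^+ n * 2 ^+ (n ^ 2 %/ 4).
Let t n : R := 2 / 2 ^+ (n %/ 8).

Let t_ge0 n : 0 <= t n.
Proof. by rewrite divr_ge0 ?exprn_ge0. Qed.

Lemma labeled_split_ge n : B n <= n.+1%:R ^+ 3 * l n.
Proof.
have := card_split_graphs_ge 'I_n; rewrite card_ord => h.
have : (2 ^ n * 2 ^ (n ^ 2 %/ 4) <= n.+1 ^ 3 * #|split_graphs 'I_n|)%N.
  apply: leq_trans (leq_mul (central_bin_ge n) (leqnn _)) _.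
  by rewrite -mulnA expnS -mulnA leq_mul2l h orbT.
by rewrite -(ler_nat R) !natrM !natrX.
Qed.

Lemma labeled_split_gt0 n : 0 < l n.
Proof.
have : 0 < n.+1%:R ^+ 3 * l n.
  by apply: lt_le_trans (labeled_split_ge n); rewrite mulr_gt0 ?exprn_gt0.
by rewrite pmulr_rgt0 // exprn_gt0.
Qed.

(** The identity contributes [l n] to the Burnside sum; every other term is nonnegative and at most
    [B n * t n ^+ m], with [m] the number of moved points. *)
Lemma unlabeled_split_bounds n :
  l n <= u n * n`!%:R <= l n + B n * ((1 + n%:R * t n) ^+ n - 1).
Proof.
have := sum_invariant_split 'I_n; rewrite card_ord => FC.
pose a (s : {perm 'I_n}) := #|[set G in split_graphs 'I_n | edge_act s @: G == G]|.
have a1 : a 1%g = num_labeled_split n.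
  apply: eq_card => G; rewrite [LHS]in_set; apply/andb_idr => _; apply/eqP.
  rewrite -[RHS]imset_id; apply: eq_imset => e.
  by rewrite /edge_act -[RHS]imset_id; apply: eq_imset => x; rewrite perm1.
have -> : u n * n`!%:R = l n + \sum_(s | s != 1%g) (a s)%:R.
  by rewrite /u -natrM -FC (bigD1 1%g) //= -/(a _) a1 natrD natr_sum.
rewrite lerDl sumr_ge0 //= lerD2l.
have aB s : (a s)%:R <= B n * t n ^+ #|moved s|.
  have := card_invariant_split s; rewrite card_ord -(ler_nat R) !natrM !natrX -/(a s).
  rewrite exprMn exprVn -exprM mulrA -ler_pdivlMr ?exprn_gt0 //.
apply: le_trans (ler_sum _ (fun s _ => aB s)) _.
rewrite -mulr_sumr; apply: ler_wpM2l; first by rewrite mulr_ge0 ?exprn_ge0.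
(* The subtracted 1 is the weight of the identity, which moves no point. *)
rewrite lerBrDl; have := sum_exp_moved 'I_n (t_ge0 n); rewrite card_ord.
by rewrite (bigD1 1%g) //= moved1 cards0 expr0.
Qed.

Lemma split_ratio_bounds n : (4 * C <= n.+1)%N ->
  1 <= u n / (l n / n`!%:R) <= 1 + (4 * C)%:R / n.+1%:R.
Proof.
move=> Cn; have l0 := labeled_split_gt0 n.
have -> : u n / (l n / n`!%:R) = u n * n`!%:R / l n by rewrite invf_div mulrA.
have /andP[lo hi] := unlabeled_split_bounds n.
rewrite ler_pdivlMr // mul1r lo ler_pdivrMr //=; apply: le_trans hi _.
rewrite mulrDl mul1r lerD2l.
set N : R := n.+1%:R; have N1 : 1 <= N by rewrite ler1n.
have nN : n%:R <= N by rewrite ler_nat.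
have tN : t n * N ^+ 6 <= 2 * C%:R.
  rewrite /t mulrAC ler_pdivrMr ?exprn_gt0 // -mulrA ler_pM2l //.
  by have := C_bound n; rewrite -(ler_nat R) natrM !natrX.
have n2t : n%:R * (n%:R * t n) <= t n * N ^+ 2.
  by rewrite mulrA mulrC ler_wpM2l // expr2 ler_pM.
have t4 : t n * N ^+ 2 * N ^+ 4 <= 2 * C%:R by rewrite -mulrA -exprD.
have N4 : 4 * C%:R <= N ^+ 4.
  apply: (@le_trans _ _ N); first by rewrite -natrM ler_nat.
  by rewrite ler_eXnr.
have N40 : 0 < N ^+ 4 by rewrite exprn_gt0 // (lt_le_trans ltr01).
(* Here [n ^ 2 * t <= 2 * C / N ^ 4], and [N ^ 4 >= 4 * C] by the threshold on [n]. *)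
have small : n%:R * (n%:R * t n) <= 2^-1.
  apply: le_trans n2t _; rewrite -(ler_pM2r N40); apply: le_trans t4 _; lra.
have v0 : 0 <= n%:R * t n by rewrite mulr_ge0.
have := expr_le_linear v0 small; rewrite -lerBlDl => ve.
apply: le_trans (ler_wpM2l _ ve) _; first by rewrite mulr_ge0 ?exprn_ge0.
apply: le_trans (ler_wpM2r _ (labeled_split_ge n)) _; first by rewrite mulr_ge0 // mulr_ge0.
rewrite -/N mulrAC; apply: ler_wpM2r; first exact: ltW.
rewrite ler_pdivlMr ?(lt_le_trans ltr01) //.
(* Three factors [N] come from [labeled_split_ge] and one from clearing the denominator; the result
   is [2 * t * N ^ 6 <= 4 * C]. *)
apply: (@le_trans _ _ (N ^+ 4 * (2 * (t n * N ^+ 2)))).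
  rewrite mulrAC -exprSr ler_wpM2l ?(ltW N40) // ler_wpM2l //.
rewrite natrM; lra.
Qed.

End RelativeError.

(* Passage to the limit *)
From mathcomp Require Import all_classical all_reals all_analysis.
Import numFieldNormedType.Exports.
Local Open Scope classical_set_scope.
Local Open Scope ring_scope.

Theorem corollary3p11 (R : realType) :
  (fun n : nat => (num_unlabeled_split n)%:R
                  / ((num_labeled_split n)%:R / (n`!)%:R) : R) @ \oo --> (1 : R).
Proof.
have [C C_bound] := exp6_le_exp2.
have bounds n := split_ratio_bounds R C_bound (n := n).
have upper : (fun n => 1 + (4 * C)%:R * n.+1%:R^-1 : R) @ \oo --> (1 : R).
  rewrite -[X in _ --> X]addr0 -[X in _ --> _ + X](mulr0 (4 * C)%:R).
  by apply: cvgD; [exact: cvg_cst|apply: cvgMr; exact: cvg_harmonic].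
(* The two-sided bound is only needed eventually, namely for [n >= 4 * C]. *)
apply: squeeze_cvgr (cvg_cst (1 : R)) upper.
near=> n; apply: bounds.
have : (4 * C <= n)%N by near: n; exact: nbhs_infty_ge.
exact: leqW.
Unshelve. all: by end_near.
Qed.
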